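(* Let $\Omega=\mathbb{R}\times(0,\pi)$ and $\lambda\ge 0$. There is no eigenfunction (that is, no solution $v\not\equiv 0$) of the problem $$\begin{cases}\Delta v=\lambda v & \text{in } \Omega,\\ v(x,0)=v(x,\pi)=0, & x\in\mathbb{R},\end{cases}$$ in the class $$\left\{v\in C^2(\Omega)\cap C(\overline{\Omega}) \;:\; \text{there exists } a\in[-\sqrt{\lambda},\sqrt{\lambda}] \text{ such that } |v(x,y)|\lesssim e^{ax}\right\}.$$
   Context: Here $(x,y)$ are the Cartesian coordinates in $\mathbb{R}^2$ and $\Delta=\partial_x^2+\partial_y^2$. Functions are real-valued. The notation $\lesssim$ denotes inequality up to a multiplicative constant: $|v(x,y)|\lesssim e^{ax}$ means that there is a constant $C>0$ such that $|v(x,y)|\le C e^{ax}$ for all $(x,y)\in\Omega$. *)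

(* Defs.v *)
(* Functions on the closed strip are encoded as total functions R * R -> R;
   no clause below looks at their values outside the closure of the strip. *)
From mathcomp Require Import all_boot all_order all_algebra.
From mathcomp Require Import all_classical all_reals all_analysis.
Set Implicit Arguments.
Unset Strict Implicit.
Unset Printing Implicit Defensive.
Import Order.TTheory GRing.Theory Num.Theory.
Import numFieldNormedType.Exports.
Local Open Scope classical_set_scope.
Local Open Scope ring_scope.

Definition e_x {R : realType} : R * R := (1, 0).
Definition e_y {R : realType} : R * R := (0, 1).

Definition dx {R : realType} (v : R * R -> R) : R * R -> R :=
  fun p => 'D_e_x v p.
Definition dy {R : realType} (v : R * R -> R) : R * R -> R :=
  fun p => 'D_e_y v p.

Definition laplacian {R : realType} (v : R * R -> R) : R * R -> R :=
  fun p => dx (dx v) p + dy (dy v) p.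

(* C^k(U), for U open. The operator 'D is total, so the existence of the
   partial derivatives is required separately. *)
Fixpoint Ck {R : realType} (k : nat) (U : set (R * R)) (v : R * R -> R) : Prop :=
  match k with
  | 0 => {within U, continuous v}
  | k'.+1 =>
      [/\ {within U, continuous v},
          forall p, U p -> derivable v p e_x /\ derivable v p e_y,
          Ck k' U (dx v) &
          Ck k' U (dy v)]
  end.

Definition strip {R : realType} : set (R * R) := [set p | 0 < p.2 < pi].

Definition in_class {R : realType} (lam : R) (v : R * R -> R) : Prop :=
  [/\ Ck 2 strip v,
      {within closure strip, continuous v} &
      exists2 a : R, - Num.sqrt lam <= a <= Num.sqrt lam &
        exists2 C : R, 0 < C &
          forall p, strip p -> `|v p| <= C * expR (a * p.1)].

Definition is_eigenfunction {R : realType} (lam : R) (v : R * R -> R) : Prop :=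
  [/\ forall p, strip p -> laplacian v p = lam * v p,
      forall x, v (x, 0) = 0 /\ v (x, pi) = 0 &
      exists2 p, closure strip p & v p != 0].

(* Main.v *)
Require Import Defs.
From mathcomp Require Import all_boot all_order all_algebra.
From mathcomp Require Import all_classical all_reals all_analysis.
From mathcomp Require Import ring lra.
Import Order.TTheory GRing.Theory Num.Theory.
Import numFieldNormedType.Exports.
Local Open Scope classical_set_scope.
Local Open Scope ring_scope.

(** The reason is a Phragmen-Lindelof principle: the growth allowed by the
bound exp(a x) with a^2 <= lam is slower than that of a positive strict
supersolution of the same equation, so the maximum principle holds on the
unbounded strip.

The comparison function is
  phi(x, y) = (exp((a + b) x) + exp((a - b) x)) (1 + y (pi - y)),
which is exp(a x) times 2 cosh(b x) times a concave profile in y that is at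
least 1 on [0, pi]. The second x-derivative of phi exceeds a^2 phi by a term
of order b phi only, while the concavity of the profile lowers the Laplacian
by twice the x-factor, an amount that does not depend on b. As a^2 <= lam,
a small b > 0 therefore makes Delta phi < lam phi on the closed strip
([barrier_strict_supersolution]).

Suppose that u is a subsolution, that u <= C exp(a x), that u <= 0 on the
boundary lines, and that u > 0 somewhere. For a small eps > 0 the function
w = u - eps phi is still positive somewhere. It is nonpositive far away,
because of the factor cosh(b x), and negative on the boundary lines, so it
attains a positive maximum at an interior point. There both of its pure
second derivatives are nonpositive ([second_derivative_at_max] on the two
coordinate lines), so Delta w <= 0, whereas
Delta w > lam u - eps lam phi = lam w >= 0. This contradiction gives u <= 0
([phragmen_lindelof_strip]); for an eigenfunction v, it applies to v and
to - v, so v vanishes. *)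

(** * Second derivatives at a maximum *)

(** The derivative [f'] vanishes at [c] and, were [l] positive, would be
positive just to the right of [c]; by the mean value theorem [f] would then
exceed [f c] there. *)
Lemma second_derivative_at_max (R : realType) (f f' : R -> R) (c d l : R) :
  0 < d ->
  (forall t, `|t - c| < d -> is_derive t 1 f (f' t)) ->
  is_derive c 1 f' l ->
  (forall t, `|t - c| < d -> f t <= f c) -> l <= 0.
Proof.
move=> d0 df df' fmax; rewrite leNgt; apply/negP => l0.
have itvd t : t \in `](c - d), (c + d)[ -> `|t - c| < d.
  by rewrite in_itv/= ltr_distl.
have f'c : f' c = 0.
  have cd : `|c - c| < d by rewrite subrr normr0.
  have df0 : is_derive c 1 f 0.
    apply: (@derive1_at_max R f (c - d) (c + d)).
    - lra.
    - by move=> t /itvd/df[].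
    - by rewrite in_itv/=; lra.
    - by move=> t /itvd; exact: fmax.
  by case: (df c cd) => _ <-; case: df0.
case: df' => cv lE; rewrite -lE /derive in l0.
have [e /= e0 eP] := cvgr_gt _ cv _ l0.
(* [c + r] stays both where [f c] is maximal and where the difference quotient
   of [f'] at [c] is positive. *)
pose r := Num.min d e / 2.
have [r0 rd re] : [/\ 0 < r, r < d & r < e].
  by rewrite /r; split; rewrite ?divr_gt0 ?lt_min ?d0//;
     case: (lerP d e) => ?; lra.
have near_c t : t \in `[c, c + r] -> `|t - c| < d.
  by rewrite in_itv/= ltr_distl => /andP[? ?]; lra.
have [|||s] := @MVT R f f' c (c + r).
- lra.
- by move=> x xr; apply: df; apply: near_c; exact: subset_itv_oo_cc xr.
- apply: derivable_within_continuous => x /near_c xd.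
  by case: (df x xd).
rewrite in_itv/= => /andP[cs sr].
rewrite (addrAC c r) subrr add0r => eqf.
have : f (c + r) <= f c.
  by apply: fmax; apply: near_c; rewrite in_itv/= lexx lerDl ltW.
apply/negP; rewrite -ltNge -subr_gt0 eqf; apply: mulr_gt0 => //.
have /= := eP (s - c); rewrite /ball/= sub0r normrN gtr0_norm ?subr_gt0//.
rewrite subr_eq0 gt_eqF// f'c subr0 [_ *: 1]mulr1 subrK.
move=> /(_ _ isT); rewrite pmulr_rgt0 ?invr_gt0 ?subr_gt0//; apply; lra.
Qed.

(** Turns the directional derivatives of which the Laplacian is made into
ordinary derivatives on a line, to which one-variable calculus applies. *)
Lemma is_derive_along_line (R : realType) (V : normedModType R) (u : V -> R)
    (q e : V) (t l : R) :
  is_derive (t *: e + q) e u l -> is_derive t 1 (fun s => u (s *: e + q)) l.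
Proof.
case=> du <-.
have E : (fun h : R => h^-1 *: (((fun s => u (s *: e + q)) \o shift t) (h *: 1)
            - u (t *: e + q)))
       = (fun h => h^-1 *: ((u \o shift (t *: e + q)) (h *: e)
            - u (t *: e + q))).
  by apply/funext => h /=; rewrite [h *: 1]mulr1 scalerDl addrA.
by split; [rewrite /derivable E|rewrite /derive E].
Qed.

(** * The supersolution *)

(** This is exp(a x) times 2 cosh(b x): the hyperbolic cosine is what makes
it dominate exp(a x) at both ends of the strip. *)
Definition growth {R : realType} (a b x : R) : R :=
  expR ((a + b) * x) + expR ((a - b) * x).
Definition growth' {R : realType} (a b x : R) : R :=
  (a + b) * expR ((a + b) * x) + (a - b) * expR ((a - b) * x).
Definition growth'' {R : realType} (a b x : R) : R :=
  (a + b) ^+ 2 * expR ((a + b) * x) + (a - b) ^+ 2 * expR ((a - b) * x).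

Lemma is_derive_growth (R : realType) (a b x t : R) :
  is_derive t 1 (fun s => growth a b (s + x)) (growth' a b (t + x)).
Proof.
by rewrite /growth; apply: is_derive_eq; rewrite /growth' /GRing.scale/=; ring.
Qed.

Lemma is_derive_growth' (R : realType) (a b x t : R) :
  is_derive t 1 (fun s => growth' a b (s + x)) (growth'' a b (t + x)).
Proof.
by rewrite /growth'; apply: is_derive_eq; rewrite /growth'' /GRing.scale/=; ring.
Qed.

Lemma growth_gt0 (R : realType) (a b x : R) : 0 < growth a b x.
Proof. by rewrite addr_gt0 ?expR_gt0. Qed.

(** Since 2 cosh(b x) >= exp(b |x|) >= 1 + b |x|, the linear factor [b * `|x|]
is a crude lower bound that already tends to infinity. *)
Lemma growth_ge (R : realType) (a b x : R) :
  0 < b -> expR (a * x) * (b * `|x|) <= growth a b x.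
Proof.
move=> b0; rewrite /growth mulrDl mulrBl !expRD -mulrDr ler_pM2l ?expR_gt0//.
have := expR_ge1Dx (b * x); have := expR_ge1Dx (- (b * x)).
have := expR_gt0 (b * x); have := expR_gt0 (- (b * x)).
have [x0|x0] := ler0P x; lra.
Qed.

(** A concave function with constant second derivative [- 2] that stays at
least 1 on [0, pi], which makes it a convenient substitute for a sine. *)
Definition profile {R : realType} (y : R) : R := 1 + y * (pi - y).

Lemma is_derive_profile (R : realType) (y t : R) :
  is_derive t 1 (fun s => profile (s + y)) (pi - 2 * (t + y)).
Proof.
by rewrite /profile; apply: is_derive_eq; rewrite /GRing.scale/=; ring.
Qed.

Lemma is_derive_profile' (R : realType) (y t : R) :
  is_derive t 1 (fun s : R => pi - 2 * (s + y)) (- 2).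
Proof. by apply: is_derive_eq; rewrite /GRing.scale/=; ring. Qed.

Lemma profile_ge1 (R : realType) (y : R) : 0 <= y <= pi -> 1 <= profile y.
Proof. by move=> /andP[y0 yp]; rewrite /profile lerDl mulr_ge0// subr_ge0. Qed.

Definition barrier {R : realType} (a b : R) (p : R * R) : R :=
  growth a b p.1 * profile p.2.

Lemma continuous_barrier (R : realType) (a b : R) : continuous (barrier a b).
Proof.
move=> p; have c1 : fst @ p --> p.1 by exact: cvg_fst.
have c2 : snd @ p --> p.2 by exact: cvg_snd.
have cE (c : R) : expR (c * r.1) @[r --> p] --> expR (c * p.1).
  apply: (cvg_comp _ expR); last exact: continuous_expR.
  by apply: cvgM => //; exact: cvg_cst.
apply: cvgM; rewrite /growth /profile; first exact: cvgD.
apply: cvgD; first exact: cvg_cst.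
by apply: cvgM => //; apply: cvgB => //; exact: cvg_cst.
Qed.

(** The left-hand side of the inequality is the Laplacian of [barrier a b].
Passing from [a] to [a + b] or [a - b] costs at most
[k = 2 * `|a| * b + b ^+ 2] in the squared exponents, and [b] is chosen so small
that [k] times the maximum of the profile is at most 1, strictly less than
the gain of 2 due to the concavity of the profile. *)
Lemma barrier_strict_supersolution (R : realType) (lam a : R) :
  a ^+ 2 <= lam -> exists2 b : R, 0 < b & forall p : R * R, 0 <= p.2 <= pi ->
    growth'' a b p.1 * profile p.2 + growth a b p.1 * - 2 < lam * barrier a b p.
Proof.
move=> alam.
(* [M] bounds the profile on [0, pi], and [b] is to be [m^-1], so that [b <= 1]
   and [(2 * `|a| + 1) * b * M = 1]. *)
pose M : R := 1 + pi ^+ 2; pose m := (1 + 2 * `|a|) * M.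
have a0 := normr_ge0 a; have M1 : 1 <= M by rewrite lerDl sqr_ge0.
have m1 : 1 <= m by rewrite /m; nra.
have b0 : 0 < m^-1 by rewrite invr_gt0; lra.
have bm : m^-1 * m = 1 by rewrite mulVf// gt_eqF//; lra.
exists m^-1 => // -[x y]; rewrite /barrier/= => yp; set b := m^-1 in b0 bm *.
have b1 : b <= 1 by nra.
have W1 := profile_ge1 _ _ yp.
have WM : profile y <= M.
  by rewrite /profile /M; have := pi_ge0 R; case/andP: yp => ? ? ?; nra.
pose k := 2 * `|a| * b + b ^+ 2.
have kM : k * M <= 1 by rewrite -bm /k /m -subr_ge0;
  rewrite (_ : _ - _ = b * M * (1 - b)); [rewrite !mulr_ge0//; lra|ring].
have k0 : 0 <= k by rewrite /k; nra.
have h1 : (a + b) ^+ 2 <= lam + k.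
  by rewrite /k; have := ler_norm a; nra.
have h2 : (a - b) ^+ 2 <= lam + k.
  by rewrite /k; have := ler_norm (- a); rewrite normrN; nra.
have G0 := growth_gt0 _ a b x.
have hG : growth'' a b x <= (lam + k) * growth a b x.
  by rewrite /growth'' /growth mulrDr lerD// ler_wpM2r// ?expR_ge0.
have kW : k * profile y <= 1 by apply: le_trans kM; rewrite ler_wpM2l.
have := ler_wpM2r (le_trans ler01 W1) hG.
have := ler_wpM2l (ltW G0) kW.
nra.
Qed.

(** * The comparison principle *)

(** The functions [ux], [uy], [uxx] and [uyy] are separate parameters, so that
the lemma applies to [- v] with the negated derivatives of [v]: the second
derivatives of [- v] need not be computed from its own first derivatives,
whose values outside the strip are unknown. *)
Lemma phragmen_lindelof_strip (R : realType) (lam a C : R)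
    (u ux uy uxx uyy : R * R -> R) :
  a ^+ 2 <= lam -> 0 <= C ->
  {within closure strip, continuous u} ->
  (forall p, strip p -> is_derive p e_x u (ux p) /\ is_derive p e_y u (uy p)) ->
  (forall p, strip p -> is_derive p e_x ux (uxx p) /\
                        is_derive p e_y uy (uyy p)) ->
  (forall p, strip p -> lam * u p <= uxx p + uyy p) ->
  (forall x, u (x, 0) <= 0 /\ u (x, pi) <= 0) ->
  (forall p, strip p -> u p <= C * expR (a * p.1)) ->
  forall p, strip p -> u p <= 0.
Proof.
move=> alam C0 uc du ddu usub ubd ubnd p0 p0S; rewrite leNgt; apply/negP => up0.
have stripW (p : R * R) : strip p -> 0 <= p.2 <= pi.
  by rewrite /strip/= => /andP[? ?]; rewrite !ltW.
have [b b0 phi_super] := barrier_strict_supersolution _ _ _ alam.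
have phi0 (p : R * R) : 0 <= p.2 <= pi -> 0 < barrier a b p.
  by move=> /profile_ge1 W1; rewrite mulr_gt0 ?growth_gt0// (lt_le_trans ltr01).
(* With this [eps], the value of [w] at [p0] is half of the value of [u]. *)
pose eps := u p0 / (2 * barrier a b p0).
have eps0 : 0 < eps by rewrite divr_gt0// mulr_gt0// phi0// stripW.
pose w p := u p - eps * barrier a b p.
have wp0 : 0 < w p0.
  have -> : w p0 = u p0 / 2.
    by rewrite /w /eps; field; rewrite gt_eqF// phi0// stripW.
  by rewrite divr_gt0.
clearbody eps.
(* Beyond [C / (eps * b)] the barrier dominates [u]; adding [`|p0.1|]
   keeps [p0] inside the truncated strip. *)
pose N := `|p0.1| + C / (eps * b).
have wfar p : strip p -> N < `|p.1| -> w p <= 0.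
  move=> pS pN; rewrite subr_le0 (le_trans (ubnd _ pS))//.
  have E0 := expR_gt0 (a * p.1).
  have CN : C <= eps * (b * `|p.1|).
    have : C / (eps * b) < `|p.1| by apply: le_lt_trans pN; rewrite /N lerDr.
    by rewrite ltr_pdivrMr ?mulr_gt0// => /ltW; rewrite mulrA mulrC.
  have W1 := profile_ge1 _ _ (stripW _ pS).
  have G := growth_ge _ a b p.1 b0.
  rewrite /barrier mulrC.
  apply: le_trans (_ : expR (a * p.1) * (eps * (b * `|p.1|)) <= _).
    by rewrite ler_pM2l.
  rewrite mulrCA ler_pM2l//; apply: (le_trans G).
  by rewrite ler_peMr// ltW// growth_gt0.
(* Intersecting with the closure of the strip, on which [u] is continuous,
   spares the computation of that closure. *)
pose K : set (R * R) := (`[- N, N] `*` `[0, pi]) `&` closure strip.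
have KP p : strip p -> `|p.1| <= N -> K p.
  move=> pS pN; split; last exact: subset_closure.
  by split; rewrite /= in_itv/= ?stripW// -ler_norml.
have [] := @compact_EVT_max _ _ w K.
- exists p0; apply: KP => //; rewrite lerDl divr_ge0// mulr_ge0// ltW//.
- apply: compact_closedI; last exact: closed_closure.
  by apply: compact_setX; exact: segment_compact.
- apply: (@continuous_subspaceW _ _ _ (closure strip)); first exact: subIsetr.
  move=> p; apply: cvgB; first exact: uc.
  apply: cvgMr; apply: continuous_subspaceT; exact: continuous_barrier.
move=> q; rewrite inE => -[[/= _ qpi] _] qmax.
rewrite in_itv/= in qpi.
have wq p : strip p -> w p <= w q.
  move=> pS; have [pN|pN] := lerP `|p.1| N.
    by apply: qmax; rewrite inE; exact: KP.
  apply: le_trans (wfar _ pS pN) _; apply: ltW; apply: lt_le_trans wp0 _.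
  by apply: qmax; rewrite inE; apply: KP => //;
     rewrite lerDl divr_ge0// mulr_ge0// ltW.
have wq0 : 0 < w q by exact: lt_le_trans wp0 (wq _ p0S).
have uq0 : 0 < u q.
  by apply: lt_le_trans wq0 _; rewrite gerBl ltW// mulr_gt0// phi0.
have qS : strip q.
  case: q qpi uq0 {qmax wq wq0} => x y; rewrite /strip/= => /andP[y0 yp] uq0.
  have [ux0 uxp] := ubd x.
  rewrite !lt_neqAle y0 yp !andbT; apply/andP; split; apply/eqP => yE.
    by move: uq0; rewrite -yE ltNge ux0.
  by move: uq0; rewrite yE ltNge uxp.
have xq s : strip (s *: e_x + q).
  by move: qS; rewrite /strip/= scaler0 add0r.
have Hx : uxx q - eps * (growth'' a b q.1 * profile q.2) <= 0.
  apply: (@second_derivative_at_max R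
    (fun s => u (s *: e_x + q) - eps * (growth a b (s + q.1) * profile q.2))
    (fun s => ux (s *: e_x + q) - eps * (growth' a b (s + q.1) * profile q.2))
    0 1) => //.
  - move=> t _.
    have := is_derive_along_line _ _ _ _ _ _ _ (du _ (xq t)).1.
    have := is_derive_growth _ a b q.1 t => dg dl.
    by apply: is_derive_eq; rewrite /GRing.scale/=; ring.
  - have := is_derive_along_line _ _ ux q e_x 0 (uxx q).
    rewrite scale0r add0r => /(_ (ddu _ qS).1).
    have := is_derive_growth' _ a b q.1 0; rewrite add0r => dg dl.
    by apply: is_derive_eq; rewrite /GRing.scale/=; ring.
  - move=> t _; rewrite scale0r !add0r.
    by have := wq _ (xq t); rewrite /w /barrier/= scaler0 add0r [t *: 1]mulr1.
have Hy : uyy q - eps * (growth a b q.1 * - 2) <= 0.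
  have /andP[q0 qp] := qS.
  pose d := Num.min q.2 (pi - q.2).
  have yq s : `|s - 0| < d -> strip (s *: e_y + q).
    rewrite subr0 lt_min !ltr_norml /strip/= [s *: 1]mulr1 => /andP[].
    by move=> /andP[? ?] /andP[? ?]; apply/andP; split; lra.
  apply: (@second_derivative_at_max R
    (fun s => u (s *: e_y + q) - eps * (growth a b q.1 * profile (s + q.2)))
    (fun s => uy (s *: e_y + q) - eps * (growth a b q.1 * (pi - 2 * (s + q.2))))
    0 d).
  - by rewrite lt_min q0 subr_gt0.
  - move=> t /yq tS.
    have := is_derive_along_line _ _ _ _ _ _ _ (du _ tS).2.
    have := is_derive_profile _ q.2 t => dg dl.
    by apply: is_derive_eq; rewrite /GRing.scale/=; ring.
  - have := is_derive_along_line _ _ uy q e_y 0 (uyy q).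
    rewrite scale0r add0r => /(_ (ddu _ qS).2).
    have := is_derive_profile' _ q.2 0 => dg dl.
    by apply: is_derive_eq; rewrite /GRing.scale/=; ring.
  - move=> t /yq tS; rewrite scale0r !add0r.
    by have := wq _ tS; rewrite /w /barrier/= scaler0 add0r [t *: 1]mulr1.
(* Adding [Hx] and [Hy] gives [uxx q + uyy q <= eps] times the Laplacian of the
   barrier, hence [lam * w q < 0]. *)
have lam0 : 0 <= lam by exact: le_trans (sqr_ge0 a) alam.
have := usub _ qS; have := phi_super _ qpi; rewrite -(ltr_pM2l eps0).
have := mulr_ge0 lam0 (ltW wq0); rewrite /w; lra.
Qed.

(** * Absence of eigenfunctions *)

Lemma closed_slab (R : realType) :
  closed [set p : R * R | 0 <= p.2 <= pi].
Proof.
have -> : [set p : R * R | 0 <= p.2 <= pi] = snd @^-1` `[0, pi].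
  by apply/seteqP; split => p /=; rewrite in_itv.
by apply: closed_comp => [p _|]; [exact: cvg_snd|exact: itv_closed].
Qed.

Theorem proposition4p1 (R : realType) (lam : R) (lam_ge0 : 0 <= lam) :
  ~ exists v : R * R -> R, in_class lam v /\ is_eigenfunction lam v.
Proof.
case=> v [[[_ dv [_ dxv _ _] [_ dyv _ _]] vc [a alam [C C0 vbnd]]]].
case=> vlap vbd [p pS vp0].
have a2 : a ^+ 2 <= lam.
  by rewrite -(sqr_sqrtr lam_ge0) -real_normK ?num_real// ler_sqr ?nnegrE
    ?sqrtr_ge0// ler_norml.
have v1 q : strip q -> is_derive q e_x v (dx v q) /\ is_derive q e_y v (dy v q).
  by move=> /dv[? ?]; split; exact/derivableP.
have v2 q : strip q -> is_derive q e_x (dx v) (dx (dx v) q) /\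
                       is_derive q e_y (dy v) (dy (dy v) q).
  by move=> qS; split; apply/derivableP; [case: (dxv _ qS)|case: (dyv _ qS)].
have vS q : strip q -> v q = 0.
  move=> qS; apply/eqP; rewrite eq_le; apply/andP; split.
    apply: (@phragmen_lindelof_strip R lam a C v) qS; try eassumption.
    - exact: ltW.
    - by move=> r /vlap <-.
    - by move=> x; have [-> ->] := vbd x.
    - by move=> r rS; exact: le_trans (ler_norm _) (vbnd _ rS).
  rewrite -oppr_le0.
  apply: (@phragmen_lindelof_strip R lam a C (fun r => - v r) (fun r => - dx v r)
    (fun r => - dy v r) (fun r => - dx (dx v) r) (fun r => - dy (dy v) r)) qS => //.
  - exact: ltW.
  - by move=> r; apply: cvgN; exact: vc.
  - by move=> r /v1[? ?]; split; exact: is_deriveN.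
  - by move=> r /v2[? ?]; split; exact: is_deriveN.
  - by move=> r /vlap; rewrite /laplacian; lra.
  - by move=> x; have [-> ->] := vbd x; rewrite oppr0.
  - move=> r rS; apply: le_trans (vbnd _ rS).
    by rewrite -normrN; exact: ler_norm.
(* The point where [v] is nonzero lies in the closure of the strip, so it may
   also be on a boundary line. *)
have : 0 <= p.2 <= pi.
  apply: (@closed_slab R); apply: closure_subset pS => r /andP[? ?] /=.
  by rewrite !ltW.
case: p vp0 {pS} => x y /eqP vp0 /=.
have [v0 vpi] := vbd x.
rewrite !le_eqVlt => /andP[/orP[/eqP y0 _|y0 /orP[/eqP yp|yp]]].
- by apply: vp0; rewrite -y0.
- by apply: vp0; rewrite yp.
- by apply: vp0; apply: vS; rewrite /strip/= y0.
Qed.
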